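(* For all positive integers $n$, $$ \mathrm{PL}(n)=\frac{1}{n!}\det\begin{bmatrix} \sigma_{2}(1) & \sigma_{2}(2) & \sigma_{2}(3) & \sigma_{2}(4) & \cdots & \cdots & \sigma_{2}(n)\\ -1 & \sigma_{2}(1) & \sigma_{2}(2) & \sigma_{2}(3) & \cdots & \cdots & \sigma_{2}(n-1)\\ 0 & -2 & \sigma_{2}(1) & \sigma_{2}(2) & \cdots & \cdots & \sigma_{2}(n-2)\\ 0 & 0 & -3 & \sigma_{2}(1) & \cdots & \cdots & \sigma_{2}(n-3)\\ 0 & 0 & 0 & -4 & \cdots & \cdots & \sigma_{2}(n-4)\\ \vdots & \vdots & \vdots & \vdots & \ddots & \ddots & \vdots\\ 0 & 0 & 0 & 0 & \cdots & -(n-1) & \sigma_{2}(1) \end{bmatrix}, $$ where $\mathrm{PL}(n)$ is the number of plane partitions of $n$. That is, the matrix is the $n\times n$ matrix whose $(i,j)$ entry is $\sigma_2(j-i+1)$ if $j\ge i$, $-(i-1)$ if $j=i-1$, and $0$ if $j<i-1$.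
   Context: A plane partition of $n$ is a two-dimensional array of non-negative integers $n_{i,j}$ ($i,j\ge 1$) that is non-increasing in both indices, that is, $n_{i,j}\ge n_{i,j+1}$ and $n_{i,j}\ge n_{i+1,j}$ for all $i,j$, and satisfies $\sum_{i,j}n_{i,j}=n$. $\mathrm{PL}(n)$ denotes the number of plane partitions of $n$; for example $\mathrm{PL}(3)=6$. For a positive integer $m$, $\sigma_{2}(m)=\sum_{d\mid m}d^{2}$ is the sum of the squares of the positive divisors of $m$. *)

(* Defs.v *)
From HB Require Import structures.
From mathcomp Require Import all_boot all_order all_algebra.
From mathcomp Require Import finmap.
From mathcomp Require Import mathcomp_extra boolp classical_sets functions.
From mathcomp Require Import cardinality fsbigop.

Set Implicit Arguments.
Unset Strict Implicit.
Unset Printing Implicit Defensive.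
Import Order.TTheory GRing.Theory Num.Theory.
Local Open Scope classical_set_scope.
Local Open Scope nat_scope.

(* Arrays are indexed from 0: [a i j] is the entry n_{i+1,j+1}.
   [\sum_(x \in A) F x] is 0 by convention when [F] has infinite support on
   [A], so finiteness of the support is required separately. *)
Definition plane_partition (n : nat) (a : nat -> nat -> nat) : Prop :=
  [/\ forall i j, a i j.+1 <= a i j,
      forall i j, a i.+1 j <= a i j,
      finite_set [set x : nat * nat | a x.1 x.2 <> 0]
    & (\sum_(x \in [set: nat * nat]) a x.1 x.2)%R = n].

(* [fset_set] of an infinite set is empty; [finite_plane_partition] below
   shows that this convention plays no role here. *)
Definition PL (n : nat) : nat :=
  #|` fset_set [set a : nat -> nat -> nat | plane_partition n a]|%fset.

Definition sigma2 (m : nat) : nat := \sum_(d <- divisors m) d ^ 2.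

(* With the 0-based indices of ['I_n], the subdiagonal entry -(i-1) of the
   1-based row i becomes [- i]. *)
Definition sigma2_mx (n : nat) : 'M[rat]_n :=
  (\matrix_(i < n, j < n)
    if (i <= j)%N then (sigma2 (j - i).+1%N)%:R
    else if i == j.+1%N :> nat then - i%:R
    else 0)%R.

Lemma plane_partition_le_sum n a (s : seq (nat * nat)) :
  plane_partition n a -> uniq s -> \sum_(x <- s) a x.1 x.2 <= n.
Proof.
case=> _ _ fin <- us.
set A := [set x : nat * nat | a x.1 x.2 <> 0].
pose F := (fset_set A `|` [fset x in s])%fset.
have -> : (\sum_(x \in [set: nat * nat]) a x.1 x.2)%R = \sum_(x <- F) a x.1 x.2.
  rewrite (@fsbig_seq nat 0 addn _ F) ?fset_uniq //.
  apply: esym; apply: fsbig_widen => // x /= [_ xF].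
  apply: contra_notP xF => ax; rewrite inE in_fset_set //.
  by apply/orP; left; rewrite inE.
have sub : {subset s <= F} by move=> x xs; rewrite !inE xs orbT.
rewrite (perm_big [seq x <- F | x \in s]); last first.
  apply: uniq_perm => //; first by rewrite filter_uniq ?fset_uniq.
  by move=> x; rewrite mem_filter; case: (boolP (x \in s)) => //= /sub ->.
rewrite big_filter big_mkcond /=; apply: leq_sum => x _.
by case: ifP.
Qed.

Lemma plane_partition_supp n a i j :
  plane_partition n a -> a i j <> 0 -> [&& i < n, j < n & a i j <= n].
Proof.
move=> pa /eqP; rewrite -lt0n => aij; have [hj hi _ _] := pa.
apply/and3P; split.
- have := @plane_partition_le_sum n a [seq (k, j) | k <- iota 0 i.+1] pa.
  rewrite map_inj_uniq ?iota_uniq; last by move=> ? ? [].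
  move/(_ isT); apply: leq_trans; rewrite big_map /=.
  rewrite -[leqLHS](size_iota 0) -sum1_size big_seq [leqRHS]big_seq.
  apply: leq_sum => k; rewrite mem_iota /= add0n ltnS => ki.
  apply: leq_trans aij _; rewrite -(subnK ki); elim: (i - k) => // d IH.
  by rewrite addSn; apply: leq_trans (hi _ _) IH.
- have := @plane_partition_le_sum n a [seq (i, k) | k <- iota 0 j.+1] pa.
  rewrite map_inj_uniq ?iota_uniq; last by move=> ? ? [].
  move/(_ isT); apply: leq_trans; rewrite big_map /=.
  rewrite -[leqLHS](size_iota 0) -sum1_size big_seq [leqRHS]big_seq.
  apply: leq_sum => k; rewrite mem_iota /= add0n ltnS => kj.
  apply: leq_trans aij _; rewrite -(subnK kj); elim: (j - k) => // d IH.
  by rewrite addSn; apply: leq_trans (hj _ _) IH.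
- have := @plane_partition_le_sum n a [:: (i, j)] pa isT.
  by rewrite big_seq1.
Qed.

Lemma finite_plane_partition n :
  finite_set [set a : nat -> nat -> nat | plane_partition n a].
Proof.
pose T := {ffun 'I_n.+1 * 'I_n.+1 -> 'I_n.+1}.
pose ext (f : T) : nat -> nat -> nat := fun i j =>
  if (i < n) && (j < n) then f (inord i, inord j) : nat else 0.
apply: (@sub_finite_set _ _ (ext @` [set: T])); last first.
  by apply: finite_image; apply: finite_finset.
move=> a /= pa; exists [ffun x : 'I_n.+1 * 'I_n.+1 => inord (a x.1 x.2)] => //.
apply/funext => i; apply/funext => j; rewrite /ext ffunE /=.
have la : a i j <= n.
  have [->//|/eqP/(plane_partition_supp pa)/and3P[]//] := eqVneq (a i j) 0.
case: ifPn => [/andP[li lj]|].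
  by rewrite !(@inordK n i, @inordK n j) ?inordK // ltnS ltnW.
by have [->|/eqP/(plane_partition_supp pa)/and3P[-> ->]] := eqVneq (a i j) 0.
Qed.

(* Main.v *)
Require Import Defs.
From mathcomp Require Import all_boot all_order all_algebra.
From mathcomp Require Import finmap mathcomp_extra boolp classical_sets functions.
From mathcomp Require Import cardinality fsbigop zify ring.

(** The theorem combines MacMahon's enumeration of plane partitions with the
    expansion of an almost triangular determinant.

    Enumeration.  Read a plane partition [a] by diagonals: the diagonals
    starting at [(0, y)] and [(x, 0)] are partitions [L 0 y] and [L x 0], and
    consecutive ones interlace.  They are the border of a two-dimensional
    growth diagram [L x y] of partitions in which every unit square obeys the
    local rule of the Robinson-Schensted-Knuth correspondence: the corner
    [L x.+1 y.+1], together with a natural number [m x y], determines and is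
    determined by the opposite corner [L x y], given the two other corners.
    Hence the border [a] can be traded for the array [m] of labels: labels are
    read off from the border by moving away from the origin
    ([growth_of_border], [growth_unique_border]), and the border is recovered
    by starting far away, where all partitions are empty, and moving back
    ([growth_of_corner], [growth_unique_corner]).  The local rule preserves
    sizes, so a double Abel summation gives
    [|a| = \sum_(x, y) (x + y + 1) * m x y] ([border_sum]).  Therefore [PL n]
    counts the arrays [m] of weight [n], where cell [(x, y)] weighs
    [x + y + 1] ([PL_weighted]); this is the generating function
    [\prod_k (1 - q ^ k) ^ - k] in combinatorial form.

    Recurrence.  Summing the total weight over all arrays of weight [n] and
    exchanging sums yields
    [n * PL n = \sum_(1 <= k <= n) sigma2 k * PL (n - k)]
    ([weighted_rec], [sum_hook_dvd]); the coefficient is [sigma2 k] because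
    [d] cells have weight [d], each contributing [d].

    Determinant.  The recurrence says that the row vector
    [(PL 0, ..., PL (n - 1))] times the matrix is [n * PL n] times the last
    unit vector.  Multiplying by the adjugate and looking at the first
    coordinate, where [PL 0 = 1], leaves a triangular minor
    ([det_recurrence]). *)

Set Implicit Arguments.
Unset Strict Implicit.
Unset Printing Implicit Defensive.
Import Order.TTheory GRing.Theory Num.Theory.
Local Open Scope nat_scope.

(** * Growth diagrams *)

Definition interlace (ka la : nat -> nat) :=
  forall k, la k.+1 <= ka k <= la k.

(** A square of partitions with corners [ka], [A], [B], [nu], where [ka] is the
    smallest and [nu] the largest.  Summed over all parts, the rule reads
    [|nu| + |ka| = |A| + |B| + m]. *)
Definition local_rule (ka A B nu : nat -> nat) (m : nat) :=
  nu 0 = maxn (A 0) (B 0) + m /\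
  forall k, nu k.+1 + ka k = maxn (A k.+1) (B k.+1) + minn (A k) (B k).

(** Partitions shrink away from the origin; the empty ones beyond [N] give the
    starting values for a recursion towards it. *)
Record growth (N : nat) (L : nat -> nat -> nat -> nat) (m : nat -> nat -> nat) :
  Prop := Growth {
    growth_interlace_x : forall x y, interlace (L x.+1 y) (L x y);
    growth_interlace_y : forall x y, interlace (L x y.+1) (L x y);
    growth_rule : forall x y,
      local_rule (L x.+1 y.+1) (L x.+1 y) (L x y.+1) (L x y) (m x y);
    growth_out : forall x y k, (N <= x) || (N <= y) -> L x y k = 0 }.

(** The two ways of completing a square from three of its corners. *)
Definition inner_corner (A B nu : nat -> nat) (k : nat) : nat :=
  maxn (A k.+1) (B k.+1) + minn (A k) (B k) - nu k.+1.

Definition outer_corner (A B ka : nat -> nat) (m k : nat) : nat :=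
  if k is k'.+1 then maxn (A k) (B k) + minn (A k') (B k') - ka k'
  else maxn (A 0) (B 0) + m.

(** Interlacing gives
    [nu k.+1 <= minn (A k) (B k)] and [maxn (A k.+1) (B k.+1) <= nu k.+1], so
    the new part lies between [maxn (A k.+1) (B k.+1)] and [minn (A k) (B k)]:
    exactly what interlacing with both [A] and [B] requires. *)
Lemma inner_corner_rule (A B nu : nat -> nat) :
  interlace A nu -> interlace B nu ->
  [/\ interlace (inner_corner A B nu) A, interlace (inner_corner A B nu) B
    & local_rule (inner_corner A B nu) A B nu (nu 0 - maxn (A 0) (B 0))].
Proof.
move=> hA hB; split; rewrite /inner_corner.
- by move=> k; have := hA k; have := hB k; have := hA k.+1; have := hB k.+1; lia.
- by move=> k; have := hA k; have := hB k; have := hA k.+1; have := hB k.+1; lia.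
- split; first by have := hA 0; have := hB 0; lia.
  by move=> k; have := hA k; have := hB k; have := hA k.+1; have := hB k.+1; lia.
Qed.

Lemma outer_corner_rule (A B ka : nat -> nat) (m : nat) :
  interlace ka A -> interlace ka B ->
  [/\ interlace A (outer_corner A B ka m), interlace B (outer_corner A B ka m)
    & local_rule ka A B (outer_corner A B ka m) m].
Proof.
move=> hA hB; split.
- case=> [|k]; first by have := hA 0; have := hB 0; rewrite /=; lia.
  by have := hA k; have := hB k; have := hA k.+1; have := hB k.+1 => /=; lia.
- case=> [|k]; first by have := hA 0; have := hB 0; rewrite /=; lia.
  by have := hA k; have := hB k; have := hA k.+1; have := hB k.+1 => /=; lia.
- split=> // k.
  by have := hA k; have := hB k; rewrite /=; lia.
Qed.

(** Recursion over the quadrant: the value at [(x.+1, y.+1)] is computed by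
    [step x y] from those at [(x, y)], [(x.+1, y)] and [(x, y.+1)], in this
    order.  It serves twice, to build a growth diagram away from the origin and
    towards it. *)
Fixpoint grid (T : Type) (left top : nat -> T)
    (step : nat -> nat -> T -> T -> T -> T) (x : nat) : nat -> T :=
  if x is x'.+1 then
    fix row y := if y is y'.+1 then
        step x' y' (grid left top step x' y') (row y') (grid left top step x' y)
      else left x
  else top.

Lemma grid_rel (T : Type) (R : T -> T -> Prop) (left top : nat -> T)
    (step : nat -> nat -> T -> T -> T -> T) (g := grid left top step) :
  (forall x, R (g x 0) (g x.+1 0)) -> (forall y, R (g 0 y) (g 0 y.+1)) ->
  (forall x y t u v, R t u -> R t v ->
    R u (step x y t u v) /\ R v (step x y t u v)) ->
  forall x y, R (g x y) (g x.+1 y) /\ R (g x y) (g x y.+1).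
Proof.
move=> hl ht hs x y; elim: y x => [|y IHy] x.
  elim: x => [|x [IHu IHv]]; first by split.
  by split; [exact: hl | case: (hs x 0 _ _ _ IHu IHv)].
have hv x' : R (g x' y.+1) (g x'.+1 y.+1).
  by have [h1 h2] := IHy x'; case: (hs x' y _ _ _ h1 h2).
split=> //; elim: x => [|x IHx]; first exact: ht.
by case: (hs x y.+1 _ _ _ (hv x) IHx).
Qed.

(** Interlacing moves a part one step down the partition at the price of one
    step in the grid; iterating bounds deep parts by parts of distant
    partitions, which are empty. *)
Lemma growth_le_shift N L m : growth N L m -> forall x y k d,
  L x y (k + d) <= L (x + d) y k /\ L x y (k + d) <= L x (y + d) k.
Proof.
move=> g x y k d; elim: d k => [|d IH] k; first by rewrite !addn0.
have [h1 h2] := IH k.+1; rewrite !addnS -!addSn; split.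
  by apply: leq_trans h1 _; case/andP: (growth_interlace_x g (x + d) y k).
by apply: leq_trans h2 _; case/andP: (growth_interlace_y g x (y + d) k).
Qed.

Lemma growth_le_axes N L m : growth N L m -> forall x y k,
  L x y k <= L 0 y k /\ L x y k <= L x 0 k.
Proof.
move=> g x y k; split.
  elim: x => // x; apply: leq_trans; by case/andP: (growth_interlace_x g x y k).
elim: y => // y; apply: leq_trans; by case/andP: (growth_interlace_y g x y k).
Qed.

Lemma growth_parts_out N L m : growth N L m -> forall x y k,
  N <= k -> L x y k = 0.
Proof.
move=> g x y k Nk; have [h _] := growth_le_shift g x y 0 k.
by move: h; rewrite add0n [leqRHS](growth_out g) ?leqn0; [move/eqP | lia].
Qed.

(** Descending induction on the distance to the empty region: the label and
    three corners of a square determine the corner closest to the origin. *)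
Lemma growth_unique_corner N L L' m : growth N L m -> growth N L' m -> L = L'.
Proof.
move=> g g'.
suff h d x y k : (N - x) + (N - y) <= d -> L x y k = L' x y k.
  by apply/funext => x; apply/funext => y; apply/funext => k; apply: h (leqnn _).
elim: d x y k => [|d IH] x y k hd.
  by rewrite (growth_out g) ?(growth_out g'); lia.
have [out|] := boolP ((N <= x) || (N <= y)).
  by rewrite (growth_out g) ?(growth_out g').
rewrite negb_or -!ltnNge => /andP[xN yN].
have [r0 rS] := growth_rule g x y; have [r0' rS'] := growth_rule g' x y.
have e1 j : L x.+1 y j = L' x.+1 y j by apply: IH; lia.
have e2 j : L x y.+1 j = L' x y.+1 j by apply: IH; lia.
have e3 j : L x.+1 y.+1 j = L' x.+1 y.+1 j by apply: IH; lia.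
case: k => [|k]; first by rewrite r0 r0' e1 e2.
by have := rS k; have := rS' k; rewrite e3 !e1 !e2; lia.
Qed.

(** Ascending induction from the axes: [L x y], [L x.+1 y] and [L x y.+1]
    determine [L x.+1 y.+1] and the label [m x y]. *)
Lemma growth_unique_border N L L' m m' : growth N L m -> growth N L' m' ->
  (forall y k, L 0 y k = L' 0 y k) -> (forall x k, L x 0 k = L' x 0 k) ->
  m = m'.
Proof.
move=> g g' b1 b2.
have e x y k : L x y k = L' x y k.
  elim: x y k => [|x IHx] y; first exact: b1.
  elim: y => [|y IHy] k; first exact: b2.
  have [_ rS] := growth_rule g x y; have [_ rS'] := growth_rule g' x y.
  by have := rS k; have := rS' k; rewrite !IHx !IHy; lia.
apply/funext => x; apply/funext => y.
have [r0 _] := growth_rule g x y; have [r0' _] := growth_rule g' x y.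
by apply/eqP; rewrite -(eqn_add2l (maxn (L x.+1 y 0) (L x y.+1 0))) -r0 !e r0'.
Qed.

Lemma growth_of_border N (a : nat -> nat -> nat) :
  (forall i j, a i j.+1 <= a i j) -> (forall i j, a i.+1 j <= a i j) ->
  (forall i j, (N <= i) || (N <= j) -> a i j = 0) ->
  exists L m, [/\ growth N L m, (forall y k, L 0 y k = a k (k + y))
     & (forall x k, L x 0 k = a (k + x) k)].
Proof.
move=> ha1 ha2 out.
pose L := grid (fun x k => a (k + x) k) (fun y k => a k (k + y))
  (fun _ _ nu A B => inner_corner A B nu).
have L0y y k : L 0 y k = a k (k + y) by [].
have Lx0 x k : L x 0 k = a (k + x) k by case: x => //=; rewrite L0y addn0.
have hL : forall x y, interlace (L x.+1 y) (L x y) /\ interlace (L x y.+1) (L x y).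
  apply: (@grid_rel _ (fun t u => interlace u t)).
  - by move=> x k; rewrite -/L !Lx0 addSn !addnS ha1 ha2.
  - by move=> y k; rewrite -/L !L0y addSn !addnS ha1 ha2.
  - by move=> _ _ nu A B hA hB; have [] := inner_corner_rule hA hB.
exists L, (fun x y => L x y 0 - maxn (L x.+1 y 0) (L x y.+1 0)); split=> //.
have anti1 x y k : L x y k <= L x 0 k.
  by elim: y => // y; apply: leq_trans; case: (hL x y) => _ /(_ k)/andP[].
have anti2 x y k : L x y k <= L 0 y k.
  by elim: x => // x; apply: leq_trans; case: (hL x y) => /(_ k)/andP[].
split=> [x y|x y|x y|x y k /orP[]h].
- by have [] := hL x y.
- by have [] := hL x y.
- by have [h1 h2] := hL x y; have [] := inner_corner_rule h1 h2.
- by apply/eqP; rewrite -leqn0 (leq_trans (anti1 x y k)) // Lx0 out; lia.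
- by apply/eqP; rewrite -leqn0 (leq_trans (anti2 x y k)) // L0y out; lia.
Qed.

(** The grid is filled from the far corner [(N, N)]; truncated subtraction makes
    it empty beyond [N]. *)
Definition growth_table (N : nat) (m : nat -> nat -> nat) (x y : nat) : nat -> nat :=
  grid (fun _ _ => 0) (fun _ _ => 0)
    (fun p q ka B A => outer_corner A B ka (m (N - p.+1) (N - q.+1))) (N - x) (N - y).

Lemma growth_of_corner N (m : nat -> nat -> nat) :
  (forall x y, (N <= x) || (N <= y) -> m x y = 0) ->
  growth N (growth_table N m) m.
Proof.
move=> out; rewrite /growth_table; set G := grid _ _ _.
have G0y y k : G 0 y k = 0 by [].
have Gx0 x k : G x 0 k = 0 by case: x.
have hG : forall x y, interlace (G x y) (G x.+1 y) /\ interlace (G x y) (G x y.+1).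
  apply: (@grid_rel _ interlace).
  - by move=> x k; rewrite -/G !Gx0.
  - by move=> y k; rewrite -/G !G0y.
  - by move=> p q ka B A hB hA;
    have [] := outer_corner_rule (m (N - p.+1) (N - q.+1)) hA hB.
have Gout x y k : (N <= x) || (N <= y) -> G (N - x) (N - y) k = 0.
  by case/orP; rewrite -subn_eq0 => /eqP->.
have pred x : x < N -> N - x = (N - x.+1).+1 by lia.
split=> [x y|x y|x y|x y k /Gout //].
- have [/pred->|Nx] := ltnP x N; first by case: (hG (N - x.+1) (N - y)).
  by move=> k; rewrite !Gout // ?Nx // leqW.
- have [/pred->|Ny] := ltnP y N; first by case: (hG (N - x) (N - y.+1)).
  by move=> k; rewrite !Gout // ?Ny ?leqW ?orbT.
- have [/andP[xN yN]|h] := boolP ((x < N) && (y < N)).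
    rewrite (pred x) // (pred y) //.
    have [hB hA] := hG (N - x.+1) (N - y.+1).
    have [_ _] := outer_corner_rule (m x y) hA hB.
    suff -> : outer_corner (G (N - x.+1) (N - y.+1).+1) (G (N - x.+1).+1 (N - y.+1))
        (G (N - x.+1) (N - y.+1)) (m x y) = G (N - x.+1).+1 (N - y.+1).+1 by [].
    by rewrite /G /= -pred // -pred // !subKn // ltnW.
  have hN : (N <= x) || (N <= y) by lia.
  by split=> [|k]; rewrite ?out // !Gout //; lia.
Qed.

(** * Sizes and weights *)

Lemma sum_shift (N k : nat) (f : nat -> nat) :
  (forall j, N <= j -> f j = 0) ->
  \sum_(y < N) f (k + y) = \sum_(j < N | k <= j) f j.
Proof.
move=> out; rewrite -(big_mkord xpredT (fun y => f (k + y))).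
rewrite -(big_mkord (fun j => k <= j) f) -(big_nat_widenl k 0 N xpredT) //.
rewrite -{2}[k]add0n big_addn.
rewrite [LHS](big_cat_nat (n := N - k)) ?leq_subr //=.
rewrite [X in _ + X = _]big_nat_cond [X in _ + X = _]big1 => [|j hj].
  by rewrite addn0; apply: eq_bigr => j _; rewrite addnC.
by apply: out; lia.
Qed.

(** The main diagonal is covered both by the upper diagonals ([y = 0]) and by
    the lower ones ([x = 0]); adding it on the left avoids a subtraction. *)
Lemma sum_diagonals (N : nat) (a : nat -> nat -> nat) :
  (forall i j, (N <= i) || (N <= j) -> a i j = 0) ->
  \sum_(i < N) \sum_(j < N) a i j + \sum_(k < N) a k k =
  \sum_(y < N) \sum_(k < N) a k (k + y) + \sum_(x < N) \sum_(k < N) a (k + x) k.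
Proof.
move=> out; rewrite [X in _ = X + _]exchange_big [X in _ = _ + X]exchange_big /=.
rewrite [X in _ = X + _](eq_bigr
  (fun k : 'I_N => \sum_(j < N | k <= j) a k j)); last first.
  by move=> k _; rewrite (sum_shift k (f := a k)) // => j hj; apply: out; lia.
rewrite [X in _ = _ + X](eq_bigr
  (fun k : 'I_N => \sum_(j < N | k <= j) a j k)); last first.
  by move=> k _; rewrite (sum_shift k (f := a^~ k)) // => j hj; apply: out; lia.
rewrite [X in _ = _ + X](exchange_big_dep xpredT) //= -!big_split /=.
apply: eq_bigr => i _; rewrite [X in _ = X + _]big_mkcond [X in _ = _ + X]big_mkcond.
rewrite -big_split /= (bigD1 i) //= [RHS](bigD1 i) //= !leqnn addnAC; congr addn.
by apply: eq_bigr => j; rewrite -val_eqE /=; case: ltngtP; rewrite ?addn0.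
Qed.

Lemma abel_sum (N : nat) (f : nat -> int) : f N = 0%R ->
  (\sum_(x < N) x.+1%:R * (f x - f x.+1) = \sum_(x < N) f x)%R.
Proof.
have: (\sum_(x < N) x.+1%:R * (f x - f x.+1) = \sum_(x < N) f x - N%:R * f N)%R.
  elim: N => [|N IH]; first by rewrite !big_ord0 mul0r subr0.
  by rewrite !big_ord_recr /= IH -natr1; ring.
by move=> -> ->; rewrite mulr0 subr0.
Qed.

(** [m] is the mixed second difference of [S].  Write the weight as
    [(y + 1) + x]: Abel summation in [y] of the first summand followed by
    telescoping in [x] leaves the sum of [S] over the axis [x = 0]; telescoping
    in [y] and Abel summation in [x] of the second leaves that over [y = 0]
    without the origin. *)
Lemma growth_weight (N : nat) (S m : nat -> nat -> nat) :
  (forall x y, (N <= x) || (N <= y) -> S x y = 0) ->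
  (forall x y, S x y + S x.+1 y.+1 = m x y + (S x.+1 y + S x y.+1)) ->
  \sum_(x < N) \sum_(y < N) (x + y).+1 * m x y + S 0 0 =
  \sum_(y < N) S 0 y + \sum_(x < N) S x 0.
Proof.
move=> out rule.
pose g x y : int := ((S x y)%:R - (S x.+1 y)%:R)%R.
have mE x y : ((m x y)%:R = g x y - g x y.+1 :> int)%R.
  by rewrite /g; have := rule x y; lia.
have gN x : g x N = 0%R by rewrite /g !out ?leqnn ?orbT.
have SN y : S N y = 0 by rewrite out ?leqnn.
have tele (f : nat -> int) : (f N = 0 -> \sum_(x < N) (f x - f x.+1) = f 0)%R.
  have -> : (\sum_(x < N) (f x - f x.+1) = f 0 - f N)%R.
    by elim: (N) => [|n IH]; rewrite ?big_ord0 ?subrr // big_ord_recr /= IH subrKA.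
  by move=> ->; rewrite subr0.
apply/eqP; rewrite -(eqr_nat int) !natrD !natr_sum; apply/eqP.
have row x : ((\sum_(y < N) (x + y).+1 * m x y)%:R =
   \sum_(y < N) g x y + (x.+1%:R * g x 0%N - g x 0%N) :> int)%R.
  rewrite -(abel_sum (f := g x)) // -(tele (g x)) // mulr_sumr -sumrB.
  rewrite -big_split natr_sum /=; apply: eq_bigr => y _.
  by rewrite natrM mE -addSn natrD -natr1; ring.
rewrite (eq_bigr _ (fun (x : 'I_N) _ => row x)) !big_split /= sumrN.
rewrite exchange_big /= (abel_sum (f := fun x => (S x 0%N)%:R)%R) ?SN //.
rewrite (tele (fun x => (S x 0%N)%:R)%R) ?SN // addrA subrK; congr (_ + _)%R.
by apply: eq_bigr => y _; rewrite (tele (fun x => (S x y)%:R)%R) ?SN.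
Qed.

(** The array whose diagonals are the partitions on the two axes. *)
Definition border (L : nat -> nat -> nat -> nat) (i j : nat) : nat :=
  if i <= j then L 0 (j - i) i else L (i - j) 0 j.

(** Neighbouring entries lie on neighbouring diagonals, so monotonicity in rows
    and columns is the interlacing of these diagonals. *)
Lemma border_anti N L m : growth N L m ->
  (forall i j, border L i j.+1 <= border L i j) /\
  (forall i j, border L i.+1 j <= border L i j).
Proof.
move=> g; rewrite /border; split=> i j.
- have [ij|ji] := leqP i j.
    by rewrite (leqW ij) subSn //; case/andP: (growth_interlace_y g 0 (j - i) i).
  have [->|ne] := eqVneq i j.+1.
    by rewrite leqnn subnn subSnn; case/andP: (growth_interlace_x g 0 0 j).
  have -> : (i <= j.+1) = false by lia.
  rewrite -(subnSK ji).
  by case/andP: (growth_interlace_x g (i - j.+1) 0 j).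
- have [ji|ij] := leqP j i; last first.
    by rewrite (ltnW ij) -(subnSK ij); case/andP: (growth_interlace_y g 0 (j - i.+1) i).
  rewrite subSn //.
  have [->|ne] := eqVneq i j.
    by rewrite leqnn subnn; case/andP: (growth_interlace_x g 0 0 j).
  have -> : (i <= j) = false by lia.
  by case/andP: (growth_interlace_x g (i - j) 0 j).
Qed.

Lemma border_out N L m : growth N L m ->
  forall i j, (N <= i) || (N <= j) -> border L i j = 0.
Proof.
move=> g i j h; rewrite /border; case: leqP => ij; apply/eqP; rewrite -leqn0.
  have [_] := growth_le_shift g 0 (j - i) 0 i.
  by rewrite add0n subnK // (growth_out g (x := 0) (y := j)) //; lia.
have [+ _] := growth_le_shift g (i - j) 0 0 j.
by rewrite add0n (subnK (ltnW ij)) (growth_out g (x := i) (y := 0)) //; lia.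
Qed.

Lemma border_row L y k : border L k (k + y) = L 0 y k.
Proof. by rewrite /border leq_addr addKn. Qed.

Lemma border_col L x k : border L (k + x) k = L x 0 k.
Proof.
rewrite /border; case: x => [|x]; first by rewrite addn0 leqnn subnn.
by rewrite leqNgt addnS ltnS leq_addr /= -addnS addKn.
Qed.

Lemma border_eq L (a : nat -> nat -> nat) :
  (forall y k, L 0 y k = a k (k + y)) -> (forall x k, L x 0 k = a (k + x) k) ->
  border L = a.
Proof.
move=> h1 h2; apply/funext => i; apply/funext => j; rewrite /border.
case: leqP => ij; first by rewrite h1 subnKC.
by rewrite h2 subnKC // ltnW.
Qed.

Lemma sum_behead N (f : nat -> nat) : f N = 0 ->
  f 0 + \sum_(k < N) f k.+1 = \sum_(k < N) f k.
Proof.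
move=> fN; rewrite -(big_ord_recl N (fun k => f (nat_of_ord k))).
by rewrite big_ord_recr /= fN addn0.
Qed.

(** Part [0] of [L x y] carries the label, the other parts pair up with those of
    [L x.+1 y.+1], and [maxn u v + minn u v = u + v]. *)
Lemma growth_sum_rule N L m : growth N L m -> forall x y,
  \sum_(k < N) L x y k + \sum_(k < N) L x.+1 y.+1 k =
  m x y + (\sum_(k < N) L x.+1 y k + \sum_(k < N) L x y.+1 k).
Proof.
move=> g x y; have [r0 rS] := growth_rule g x y.
have out x' y' : L x' y' N = 0 by apply: growth_parts_out g _ _ _ (leqnn _).
pose M k := maxn (L x.+1 y k) (L x y.+1 k).
pose I k := minn (L x.+1 y k) (L x y.+1 k).
have e : \sum_(k < N) L x y k.+1 + \sum_(k < N) L x.+1 y.+1 k =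
    \sum_(k < N) M k.+1 + \sum_(k < N) I k.
  by rewrite -!big_split; apply: eq_bigr => k _; exact: rS.
have MI : \sum_(k < N) M k + \sum_(k < N) I k =
    \sum_(k < N) L x.+1 y k + \sum_(k < N) L x y.+1 k.
  by rewrite -!big_split; apply: eq_bigr => k _; rewrite /= /M /I; lia.
rewrite -(sum_behead (f := L x y)) // r0 -/(M 0) -addnA e -MI.
have MN : M N = 0 by rewrite /M !out.
by rewrite -(sum_behead MN) [M 0 + m x y]addnC -!addnA.
Qed.

Lemma border_sum N L m : growth N L m ->
  \sum_(i < N) \sum_(j < N) border L i j =
  \sum_(x < N) \sum_(y < N) (x + y).+1 * m x y.
Proof.
move=> g; pose S x y := \sum_(k < N) L x y k.
have Sout x y : (N <= x) || (N <= y) -> S x y = 0.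
  by move=> h; apply: big1 => k _; apply: (growth_out g).
have := growth_weight Sout (growth_sum_rule g).
have row y : \sum_(k < N) border L k (k + y) = S 0 y.
  by apply: eq_bigr => k _; rewrite border_row.
have col x : \sum_(k < N) border L (k + x) k = S x 0.
  by apply: eq_bigr => k _; rewrite border_col.
have diag : \sum_(k < N) border L k k = S 0 0.
  by rewrite -(row 0); apply: eq_bigr => k _; rewrite addn0.
have := sum_diagonals (border_out g).
rewrite diag (eq_bigr _ (fun y _ => row _)) (eq_bigr _ (fun y _ => col _)).
by move=> <- /addIn.
Qed.

Lemma fsum_box N (a : nat -> nat -> nat) :
  (forall i j, (N <= i) || (N <= j) -> a i j = 0) ->
  ((\sum_(x \in [set: nat * nat]) a x.1 x.2)%R : nat) =
  \sum_(i < N) \sum_(j < N) a i j.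
Proof.
move=> out; pose s := [seq (i, j) | i <- iota 0 N, j <- iota 0 N].
have us : uniq s by rewrite allpairs_uniq ?iota_uniq // => -[? ?] [? ?].
transitivity (\sum_(x <- s) a x.1 x.2).
  rewrite (@fsbig_seq nat 0 addn _ s) //.
  apply: esym; apply: fsbig_widen => // -[i j] /= [_ xF].
  apply: out; apply: contra_notT xF; rewrite negb_or -!ltnNge => /andP[iN jN].
  by apply/allpairsP; exists (i, j); rewrite !mem_iota.
have iE : iota 0 N = index_iota 0 N by rewrite /index_iota subn0.
rewrite big_allpairs iE (big_mkord xpredT (fun i => _)).
by apply: eq_bigr => i _; rewrite (big_mkord xpredT (fun j => _)).
Qed.

(** * Plane partitions as weighted arrays *)

(** Multisets on [C] of total weight [n], given by their multiplicities.  The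
    bound [B] only serves to obtain a finite type: for positive weights and
    [n <= B] it excludes nothing. *)
Definition weighted (C : finType) (w : C -> nat) (B n : nat) :
    {set {ffun C -> 'I_B.+1}} :=
  [set f : {ffun C -> 'I_B.+1} | \sum_c w c * f c == n].

(** The length of the hook running from the cell to the two axes. *)
Definition hook N (c : 'I_N * 'I_N) : nat := (c.1 + c.2).+1.

Definition extend N B (f : {ffun 'I_N * 'I_N -> 'I_B.+1}) (x y : nat) : nat :=
  if insub x is Some i then if insub y is Some j then f (i, j) else 0 else 0.

Lemma extend_ord N B (f : {ffun 'I_N * 'I_N -> 'I_B.+1}) (i j : 'I_N) :
  extend f i j = f (i, j).
Proof. by rewrite /extend !valK. Qed.

Lemma extend_out N B (f : {ffun 'I_N * 'I_N -> 'I_B.+1}) x y :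
  (N <= x) || (N <= y) -> extend f x y = 0.
Proof.
move=> h; rewrite /extend; case: insubP => // i xN _.
by case: insubP => // j yN _; move: h; rewrite leqNgt xN leqNgt yN.
Qed.

Lemma plane_partition_box N n a : n <= N ->
  plane_partition n a -> forall i j, (N <= i) || (N <= j) -> a i j = 0.
Proof.
move=> nN pa i j; apply: contraTeq => /eqP /(plane_partition_supp pa).
by case/and3P => hi hj _; lia.
Qed.

(** MacMahon's theorem: [m |-> border (growth_table N m)] is a bijection from
    arrays of hook weight [n] to plane partitions of [n].  The square may be
    any one of side [N >= n], which allows the same [N] for all terms of the
    recurrence. *)
Lemma PL_weighted N n : n <= N -> PL n = #|weighted (@hook N) N n|.
Proof.
move=> nN.
pose psi (f : {ffun 'I_N * 'I_N -> 'I_N.+1}) := border (growth_table N (extend f)).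
have gf f := growth_of_corner (@extend_out N N f).
have wt (m : nat -> nat -> nat) : \sum_(x < N) \sum_(y < N) (x + y).+1 * m x y =
    \sum_(c : 'I_N * 'I_N) hook c * m c.1 c.2 by rewrite pair_bigA.
have wf f : \sum_(c : 'I_N * 'I_N) hook c * extend f c.1 c.2 =
    \sum_(c : 'I_N * 'I_N) hook c * f c.
  by apply: eq_bigr => -[i j] _; rewrite extend_ord.
(* The label array can be read off from the border. *)
have psi_inj : injective psi.
  move=> f f' e; apply/ffunP => -[i j]; apply: val_inj; rewrite /= -!extend_ord.
  suff -> : extend f = extend f' by [].
  apply: growth_unique_border (gf f) (gf f') _ _ => [y k|x k].
    by rewrite -!border_row -/(psi f) e.
  by rewrite -!border_col -/(psi f) e.
suff imE : [set a | plane_partition n a]%classic =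
    [set` [fset psi f | f in weighted (@hook N) N n]%fset]%classic.
  by rewrite /PL imE set_fsetK card_imfset //= cardE.
apply/seteqP; split => a /=; last first.
  case/imfsetP => f /=; rewrite inE => /eqP fn ->.
  have out := border_out (gf f); have [h1 h2] := border_anti (gf f).
  split=> //; last by rewrite (fsum_box out) (border_sum (gf f)) wt wf.
  apply: (@sub_finite_set _ _
    [set` [seq (i, j) | i <- iota 0 N, j <- iota 0 N]]%classic) => //.
  move=> [i j] /= aij; apply/allpairsP; exists (i, j); rewrite !mem_iota /=.
  by split=> //; rewrite add0n ltnNge; apply/negP => hN;
    apply: aij; apply: out; rewrite hN ?orbT.
move=> pa; have [h1 h2 _ sa] := pa.
have out := plane_partition_box nN pa.
(* Surjectivity: the labels [m] of the growth diagram bordered by [a] give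
   back that diagram. *)
have [L [m [gL b1 b2]]] := growth_of_border h1 h2 out.
have aE := border_eq b1 b2.
have mB x y : m x y < N.+1.
  have [r0 _] := growth_rule gL x y.
  have [le1 _] := growth_le_axes gL x y 0; have [_ le2] := growth_le_axes gL 0 y 0.
  have : m x y <= a 0 0.
    by rewrite -aE; apply: leq_trans (leq_trans le1 le2); rewrite r0 leq_addl.
  rewrite ltnS => /leq_trans; apply.
  have [->//|/eqP/(plane_partition_supp pa)/and3P[_ _]] := eqVneq (a 0 0) 0.
  by move=> /leq_trans; apply.
pose f := [ffun c : 'I_N * 'I_N => Ordinal (mB c.1 c.2)].
have mE : extend f = m.
  apply/funext => x; apply/funext => y.
  have [h|] := boolP ((N <= x) || (N <= y)).
    rewrite extend_out //; have [] := growth_rule gL x y.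
    by rewrite (growth_out gL) // => /esym/eqP; rewrite addn_eq0 => /andP[_ /eqP].
  rewrite negb_or -!ltnNge => /andP[xN yN].
  by rewrite -[x]/(nat_of_ord (Ordinal xN)) -[y]/(nat_of_ord (Ordinal yN))
    extend_ord ffunE.
have LE : growth_table N (extend f) = L.
  by apply: growth_unique_corner (gf f) _; rewrite mE.
apply/imfsetP; exists f => /=; last by rewrite /psi LE aE.
by rewrite inE -wf mE -wt -(border_sum gL) aE -(fsum_box out) sa.
Qed.

(** * The recurrence *)

Lemma count_multiples (w m n : nat) : 0 < w -> w * m <= n ->
  \sum_(1 <= k < n.+1 | w %| k) (k %/ w <= m) = m.
Proof.
move=> w0 wm; rewrite (big_cat_nat (n := (w * m).+1)) //= [X in _ + X]big_nat_cond.
rewrite [X in _ + X]big1 ?addn0 => [|k /andP[/andP[hk _] /dvdnP[q kq]]]; last first.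
  by move: hk; rewrite kq mulnK // [q * w]mulnC ltn_mul2l w0 /= ltnNge => /negbTE->.
transitivity (\sum_(1 <= k < (w * m).+1) (w %| k)); last first.
  by rewrite -divn_count_dvd mulKn.
rewrite big_mkcond /=; apply: congr_big_nat => // k /andP[_]; rewrite ltnS => hk.
case: ifP => // /dvdnP[q kq]; move: hk.
by rewrite kq mulnK // [q * w]mulnC leq_pmul2l // => /andP[_ ->].
Qed.

(** Removing [t] copies of [c] from a multiset is a bijection onto the multisets
    of weight [n - t * w c]. *)
Lemma weighted_shift (C : finType) (w : C -> nat) (B n : nat) (c : C) (t : nat) :
  (forall c, 0 < w c) -> n <= B -> t * w c <= n ->
  #|[set f in weighted w B n | t <= f c]| = #|weighted w B (n - t * w c)|.
Proof.
move=> w0 nB tn.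
pose add (g : {ffun C -> 'I_B.+1}) : {ffun C -> 'I_B.+1} :=
  [ffun d => inord (g d + t * (d == c))].
have val_le m (g : {ffun C -> 'I_B.+1}) d : g \in weighted w B m -> g d <= m.
  rewrite inE => /eqP <-; rewrite (bigD1 d) //= (leq_trans _ (leq_addr _ _)) //.
  by rewrite leq_pmull.
have addE (g : {ffun C -> 'I_B.+1}) d : g \in weighted w B (n - t * w c) ->
    add g d = g d + t * (d == c) :> nat.
  move=> /val_le-/(_ d) gd; rewrite ffunE inordK // ltnS (leq_trans _ nB) //.
  have : t * (d == c) <= t * w c by rewrite leq_mul2l; case: (d == c); rewrite /= ?w0 orbT.
  by lia.
have sumE (g h : {ffun C -> 'I_B.+1}) : (forall d, h d = g d + t * (d == c) :> nat) ->
    \sum_d w d * h d = \sum_d w d * g d + t * w c.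
  move=> hE; rewrite (eq_bigr (fun d => w d * g d + (d == c) * (t * w c))).
    rewrite big_split /= -big_distrl /=; congr (_ + _).
    by rewrite (bigD1 c) //= eqxx big1 ?addn0 ?mul1n // => d /negbTE->.
  move=> d _; rewrite hE mulnDr; congr (_ + _); case: eqP => [->|_].
    by rewrite muln1 mul1n mulnC.
  by rewrite !muln0.
rewrite -(card_in_imset (f := add) (D := weighted w B (n - t * w c))); last first.
  move=> g h gW hW e; apply/ffunP => d; apply/val_inj => /=.
  by have := addE h d hW; rewrite -e (addE g d gW) => /addIn.
apply: eq_card => f; rewrite !inE; apply/andP/imsetP => [[/eqP fW tf]|[g gW ->]].
  pose g : {ffun C -> 'I_B.+1} := [ffun d => inord (f d - t * (d == c))].
  have gE d : f d = g d + t * (d == c) :> nat.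
    rewrite ffunE inordK; last by rewrite (leq_ltn_trans (leq_subr _ _)).
    by rewrite subnK //; case: eqP => [->|_]; rewrite ?muln1 ?muln0.
  have gW : g \in weighted w B (n - t * w c).
    by rewrite inE -fW (sumE g f) // addnK.
  by exists g => //; apply/ffunP => d; apply: val_inj; rewrite /= addE.
rewrite (sumE g) => [|d]; last exact: addE.
split; last by rewrite addE // eqxx muln1 leq_addl.
by move: gW; rewrite inE => /eqP->; rewrite subnK.
Qed.

(** Count pairs of a multiset and a unit of its weight: the multiplicity [f c]
    is the number of [t >= 1] with [t <= f c], and the multisets containing [t]
    copies of [c] are counted by [weighted_shift].  Indexing by [k = t * w c]
    collects the terms with the same remaining weight. *)
Lemma weighted_rec (C : finType) (w : C -> nat) (B n : nat) :
  (forall c, 0 < w c) -> n <= B ->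
  n * #|weighted w B n| =
  \sum_(1 <= k < n.+1) (\sum_(c | w c %| k) w c) * #|weighted w B (n - k)|.
Proof.
move=> w0 nB; rewrite mulnC -sum_nat_const.
transitivity (\sum_(f in weighted w B n) \sum_c
    \sum_(1 <= k < n.+1 | w c %| k) w c * (k %/ w c <= f c)).
  apply: eq_bigr => f; rewrite inE => /eqP fn; rewrite -[LHS]fn.
  apply: eq_bigr => c _; rewrite -big_distrr /= count_multiples //.
  by rewrite -fn (bigD1 c) //= leq_addr.
rewrite exchange_big /=.
under eq_bigr => c _ do rewrite exchange_big /=.
rewrite (exchange_big_dep xpredT) //= big_nat [RHS]big_nat.
apply: eq_bigr => k /andP[_ kn]; rewrite big_distrl /=.
apply: eq_bigr => c wk; rewrite -big_distrr /=; congr (_ * _).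
rewrite -[in RHS](divnK wk) -weighted_shift // ?divnK //.
rewrite -sum1_card [LHS]big_mkcond [RHS]big_mkcond /=; apply: eq_bigr => f _.
by rewrite [in RHS]inE; case: (f \in _); case: (_ <= _).
Qed.

(** For [d <= N] exactly [d] cells [(x, d - 1 - x)] have weight [d]. *)
Lemma sum_hook_dvd N k : 0 < k <= N ->
  \sum_(c : 'I_N * 'I_N | hook c %| k) hook c = sigma2 k.
Proof.
case/andP=> k0 kN; pose f d := if d.+1 %| k then d.+1 else 0.
have fN d : N <= d -> f d = 0.
  by move=> Nd; rewrite /f gtnNdvd //; lia.
rewrite big_mkcond /= -(pair_bigA _ (fun x y : 'I_N => f (x + y))) /=.
under eq_bigr => x _ do rewrite sum_shift //.
rewrite (exchange_big_dep xpredT) //=.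
transitivity (\sum_(j < N | j.+1 %| k) j.+1 ^ 2).
  rewrite [RHS]big_mkcond /=; apply: eq_bigr => j _; rewrite sum_nat_const.
  have -> : #|[pred x : 'I_N | x <= j]| = j.+1.
    rewrite -sum1_card -(big_mkord (fun x => x <= j) (fun _ => 1)).
    rewrite -(big_nat_widen 0 j.+1 N xpredT (fun _ => 1)) //.
    by rewrite sum_nat_const_nat subn0 muln1.
  by rewrite /f; case: ifP; rewrite ?muln0.
rewrite -(big_mkord (fun j => j.+1 %| k) (fun j => j.+1 ^ 2)).
rewrite -(big_add1 _ _ 0 N.+1 (fun d => d %| k) (fun d => d ^ 2)) /sigma2.
rewrite -[LHS]big_filter; apply: perm_big; apply: uniq_perm.
- by rewrite filter_uniq ?iota_uniq.
- exact: divisors_uniq.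
move=> d; rewrite mem_filter mem_index_iota -dvdn_divisors //.
case: (boolP (d %| k)) => //= dk.
by rewrite (dvdn_gt0 k0 dk) ltnS (leq_trans (dvdn_leq k0 dk)).
Qed.

(** * The determinant *)

(** Cramer's rule in the form [v *m A *m \adj A = \det A *: v], at coordinate
    [0].  There [v] is [1], and the adjugate entry is the signed minor without
    first row and last column, triangular with diagonal [-1, ..., -n]. *)
Lemma det_recurrence (R : comNzRingType) (n : nat) (s p : nat -> R) :
  (p 0%N = 1)%R ->
  (forall j, (j <= n)%N ->
    j.+1%:R * p j.+1 = \sum_(i < j.+1) p i * s (j - i).+1%N)%R ->
  (\det (\matrix_(i < n.+1, j < n.+1)
      if (i <= j)%N then s (j - i).+1%N
      else if i == j.+1 :> nat then - i%:R else 0)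
   = (n.+1)`!%:R * p n.+1)%R.
Proof.
move=> p0 rec; set A := (\matrix_(i, j) _)%R.
pose v : 'rV[R]_n.+1 := (\row_i p i)%R.
(* Column [j < n] vanishes: the subdiagonal entry [- j.+1] cancels the
   convolution; the last column has no subdiagonal entry. *)
have vA : (v *m A = (n.+1%:R * p n.+1) *: delta_mx 0 ord_max)%R.
  apply/rowP => j; rewrite !mxE eqxx /=.
  have conv : (\sum_(i < n.+1 | (i <= j)%N) p i * s (j - i).+1%N = j.+1%:R * p j.+1)%R.
    rewrite rec; last by rewrite -ltnS.
    by rewrite (big_ord_widen n.+1 (fun i => p i * s (j - i).+1%N)%R).
  rewrite (bigID (fun i : 'I_n.+1 => i <= j)) /=.
  rewrite (eq_bigr (fun i : 'I_n.+1 => p i * s (j - i).+1%N)%R) => [|i ij]; last first.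
    by rewrite !mxE ij.
  rewrite conv.
  have [->|jn] := eqVneq j ord_max.
    rewrite big1 ?addr0 ?mulr1 // => i; rewrite -ltnNge ltnNge => /negP[].
    by rewrite -ltnS.
  rewrite mulr0.
  have jn' : j.+1 < n.+1.
    by rewrite ltn_neqAle ltn_ord andbT eqSS; apply: contraNneq jn => e; apply/eqP/val_inj.
  rewrite (bigD1 (Ordinal jn')) /= -?ltnNge // !mxE /= ltnn eqxx mulrN mulrC.
  rewrite big1 ?addr0 ?subrr // => i /andP[ij ne].
  by rewrite !mxE (negbTE ij) ifF ?mulr0 //; apply: contraNF ne => /eqP e; apply/eqP/val_inj.
have minor : (\det (row' ord0 (col' ord_max A)) = (-1) ^+ n * n`!%:R)%R.
  rewrite -det_tr det_trig; last first.
    apply/is_trig_mxP => i j ij; rewrite !mxE !lift0 /= /bump.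
    rewrite [n <= i]leqNgt ltn_ord add0n eqSS gtn_eqF //.
    by rewrite leqNgt ltnS (ltnW ij).
  rewrite (eq_bigr (fun i : 'I_n => -1 * i.+1%:R)%R) => [|i _]; last first.
    rewrite !mxE lift0 /= /bump [n <= i]leqNgt ltn_ord add0n ltnn eqxx; ring.
  rewrite big_split prodr_const card_ord /= -natr_prod; congr (_ * _%:R)%R.
  by rewrite fact_prod big_add1 /= big_mkord.
have := congr1 (fun B => B *m \adj A)%R vA; rewrite -mulmxA mul_mx_adj.
move/rowP/(_ ord0); rewrite mul_mx_scalar -scalemxAl !mxE p0 mulr1 => ->.
rewrite (bigD1 ord_max) //= big1 ?addr0 => [|j jn]; last first.
  by rewrite !mxE (negbTE jn) andbF mul0r.
rewrite !mxE !eqxx mul1r /cofactor add0n minor signrMK factS natrM; ring.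
Qed.

Lemma card_weighted0 (C : finType) (w : C -> nat) (B : nat) :
  (forall c, 0 < w c) -> #|weighted w B 0| = 1.
Proof.
move=> w0; apply/eqP/cards1P; exists [ffun => ord0]; apply/setP => f.
rewrite !inE sum_nat_eq0; apply/forallP/eqP => [h|-> c]; last by rewrite ffunE muln0.
apply/ffunP => c; apply: val_inj; rewrite ffunE /=.
by move: (h c); rewrite /= muln_eq0 gtn_eqF // => /eqP.
Qed.

Theorem mainTheorem4 (n : nat) (hn : (0 < n)%N) :
  ((PL n)%:R = (n`!)%:R^-1 * \det (sigma2_mx n) :> rat)%R.
Proof.
case: n hn => // n _.
pose W k := #|weighted (@hook n.+1) n.+1 k|.
rewrite (PL_weighted (leqnn _)) -/(W n.+1) /sigma2_mx.
rewrite (det_recurrence (s := fun k => (sigma2 k)%:R%R) (p := fun k => (W k)%:R%R)).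
- by rewrite mulKf // pnatr_eq0 -lt0n fact_gt0.
- by rewrite /W card_weighted0.
move=> j jn; rewrite -natrM.
under eq_bigr => i _ do rewrite -natrM.
rewrite -natr_sum weighted_rec //; congr (_%:R)%R.
rewrite big_add1 big_mkord (reindex_inj rev_ord_inj) /=.
apply: eq_bigr => i _; have := ltn_ord i => ij.
rewrite sum_hook_dvd; last by lia.
by rewrite mulnC -/(W _); congr (W _ * sigma2 _); lia.
Qed.
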